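(* Let $k$ be a field, $R=k[[x]]$ and $w=\sum_{i=2}^\infty r_ix^i\in R$ with $r_i\in k$, $w \neq 0$. Let $A$ be the endomorphism dg algebra of the stabilized residue field of $w$ and let $h$ be the contracting homotopy of $A$ specified in the context. Then the unital $A_\infty$-structure on $H^*(A)\cong k1\oplus k\overline\partial$ induced by this homotopy is uniquely determined by the formulas $$m_i(\overline\partial,\dots,\overline\partial)=\pm r_i\qquad(i\ge2).$$
   Context: The dg algebra: $A=k[[x]]\otimes_kk\langle\theta,\partial\rangle$, $\mathbb Z/2$-graded with $x$ even, $\theta,\partial$ odd, $x$ central, $\theta^2=\partial^2=0$, $\theta\partial+\partial\theta=1$, with $k[[x]]$-linear differential (a derivation) $d\theta=x$, $d\partial=w/x$. The homotopy: for $a\in k[[x]]$ write $a=a_0+\overline a$ with $a_0\in k$, $\overline a\in xk[[x]]$. Put $h(a)=\frac{\overline a}{x}\theta$ and extend $k\langle\theta,\partial\rangle$-linearly to $A$, i.e. $h(a\xi)=\frac{\overline a}{x}\theta\xi$ for $\xi\in k\langle\theta,\partial\rangle$. Then $p=\mathrm{id}-(dh+hd)$ is a projection commuting with $d$, whose image is the complex $k1\oplus k\overline\partial$ with zero differential, embedded by $\iota(1)=1$, $\iota(\overline\partial)=\partial-\frac{w}{x^2}\theta$; this identifies it with $H^*(A)$. Induced $A_\infty$-structure: the one obtained by homotopy transfer along $(\iota,p,h)$ (sum over trees): $m_1=0$ and, for $n\ge2$, $m_n=p\circ\lambda_n\circ\iota^{\otimes n}$, where $\lambda_2$ is the product of $A$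 and recursively $\lambda_n=\sum_{s+t=n,\ s,t\ge1}\pm\lambda_2(h\lambda_s\otimes h\lambda_t)$ with $h\lambda_1$ interpreted as $\pm\mathrm{id}$, with the standard signs of the homotopy transfer theorem. ''Unital'' means strictly unital with unit $1$. The symbol $\pm$ in the claim is a sign depending on $i$ and the sign conventions. *)

(* Defs.v *)
From HB Require Import structures.
From mathcomp Require Import all_boot all_order all_algebra.
From mathcomp Require Import boolp.
From mathcomp Require Import ring.

Set Implicit Arguments.
Unset Strict Implicit.
Unset Printing Implicit Defensive.

Import GRing.Theory.
Local Open Scope ring_scope.

(** * Formal power series in one variable *)

Record fps (k : comNzRingType) := FPS { fps_coef :> nat -> k }.

Section PowerSeries.
Context {k : comNzRingType}.
Implicit Types f g h : fps k.

Lemma fpsP f g : (forall n, f n = g n) -> f = g.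
Proof. by case: f => f; case: g => g /= fg; congr FPS; apply: funext. Qed.

HB.instance Definition _ := gen_eqMixin (fps k).
HB.instance Definition _ := gen_choiceMixin (fps k).

Definition fpsC (c : k) : fps k := FPS (fun n => if n is 0%N then c else 0).
Definition fpsX : fps k := FPS (fun n => (n == 1%N)%:R).
Definition fps_opp f : fps k := FPS (fun n => - f n).
Definition fps_add f g : fps k := FPS (fun n => f n + g n).
Definition fps_mul f g : fps k :=
  FPS (fun n => \sum_(i < n.+1) f i * g (n - i)%N).

Fact fps_addA : associative fps_add.
Proof. by move=> f g h; apply: fpsP => n /=; rewrite addrA. Qed.
Fact fps_addC : commutative fps_add.
Proof. by move=> f g; apply: fpsP => n /=; rewrite addrC. Qed.
Fact fps_add0 : left_id (fpsC 0) fps_add.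
Proof. by move=> f; apply: fpsP => -[|n] /=; rewrite add0r. Qed.
Fact fps_addN : left_inverse (fpsC 0) fps_opp fps_add.
Proof. by move=> f; apply: fpsP => -[|n] /=; rewrite addNr. Qed.

HB.instance Definition _ :=
  GRing.isZmodule.Build (fps k) fps_addA fps_addC fps_add0 fps_addN.

Let trunc N f : {poly k} := \poly_(i < N) f i.

Let fps_mulE N n f g :
  (n < N)%N -> fps_mul f g n = (trunc N f * trunc N g)`_n.
Proof.
move=> ltnN; rewrite coefM; apply: eq_bigr => i _; rewrite !coef_poly.
rewrite (leq_ltn_trans _ ltnN) ?(leq_ltn_trans (leq_subr _ _) ltnN) //.
by rewrite -ltnS.
Qed.

Fact fps_mulC : commutative fps_mul.
Proof. by move=> f g; apply: fpsP => n; rewrite !(fps_mulE _ _ (ltnSn n)) mulrC. Qed.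

Fact fps_mulA : associative fps_mul.
Proof.
move=> f g h; apply: fpsP => n.
transitivity ((trunc n.+1 f * (trunc n.+1 g * trunc n.+1 h))`_n).
  rewrite coefM; apply: eq_bigr => i _.
  by rewrite (@fps_mulE n.+1) ?ltnS ?leq_subr // coef_poly ltn_ord.
rewrite mulrA coefM; apply: eq_bigr => i _.
by rewrite (@fps_mulE n.+1) // coef_poly ltnS leq_subr.
Qed.

Fact fps_mul1 : left_id (fpsC 1) fps_mul.
Proof.
move=> f; apply: fpsP => n /=.
by rewrite big_ord_recl mul1r subn0 big1 ?addr0 // => i _; rewrite mul0r.
Qed.

Fact fps_mulDl : left_distributive fps_mul fps_add.
Proof.
move=> f g h; apply: fpsP => n /=; rewrite -big_split.
by apply: eq_bigr => i _; rewrite mulrDl.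
Qed.

Fact fps_1neq0 : fpsC 1 != 0 :> fps k.
Proof.
by apply/eqP => /(congr1 (fun f : fps k => f 0%N))/eqP; rewrite oner_eq0.
Qed.

HB.instance Definition _ := GRing.Zmodule_isComNzRing.Build (fps k)
  fps_mulA fps_mulC fps_mul1 fps_mulDl fps_1neq0.

(** For [f = f_0 + fbar] with [fbar] divisible by [x], [fps_divX f = fbar / x]. *)
Definition fps_divX f : fps k := FPS (fun n => f n.+1).

Lemma fps_mulXE f n : (fpsX * f) n = if n is m.+1 then f m else 0.
Proof.
case: n => [|n]; rewrite /= big_ord_recl mul0r add0r ?big_ord0 //.
rewrite big_ord_recl /= mul1r big1 ?addr0 ?subSS ?subn0 //.
by move=> i _; rewrite mul0r.
Qed.

Lemma fps_divXK f : fpsX * fps_divX f = f - fpsC (f 0%N).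
Proof.
apply: fpsP => -[|n]; rewrite fps_mulXE /= ?subrr //.
by rewrite subr0.
Qed.

Lemma fps_divXM f : fps_divX (fpsX * f) = f.
Proof. by apply: fpsP => n; rewrite /= -[RHS](fps_mulXE f n.+1). Qed.

Lemma fps_divXD f g : fps_divX (f + g) = fps_divX f + fps_divX g.
Proof. exact: fpsP. Qed.

Lemma fps_mulCE f (c : k) n : (f * fpsC c) n = f n * c.
Proof.
rewrite mulrC /= big_ord_recl subn0 big1 ?addr0 1?mulrC // => i _.
by rewrite mul0r.
Qed.

End PowerSeries.

(** * A-infinity structures on Z/2-graded modules

  A Z/2-grading on [V] is given by its two projections: [pr b] is the projection
  onto the part of parity [b] ([false] even, [true] odd).  A family of
  operations [m_n : V^n -> V], [n >= 1], is encoded as one function on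
  sequences: [m_n (v_1, ..., v_n)] is [m [:: v_1; ...; v_n]].  The value of [m]
  at [[::]] carries no meaning. *)

Definition signop (V : zmodType) (pr : bool -> V -> V) (v : V) : V :=
  pr false v - pr true v.

Section AInfinity.
Context {k : fieldType} {V : lmodType k}.
Variable pr : bool -> V -> V.
Implicit Types (m : seq V -> V) (vs : seq V) (ps : seq bool).

Definition multilinear m :=
  forall vs1 vs2 (a : k) (u v : V),
    m (vs1 ++ (a *: u + v) :: vs2) =
    a *: m (vs1 ++ u :: vs2) + m (vs1 ++ v :: vs2).

(** [m_n] has degree [2 - n], that is, parity [odd n]. *)
Definition graded_ops m :=
  forall vs ps, vs != [::] ->
    all2 (fun p v => pr p v == v) ps vs ->
    pr (odd (size vs) (+) odd (count id ps)) (m vs) = m vs.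

(** [\sum_(r+s+t = n) (-1)^(r+st) m_(r+1+t) (1^r (x) m_s (x) 1^t) = 0]; by the
  Koszul rule, moving [m_s], of parity [odd s], past [v_1, ..., v_r] applies
  [signop ^ s] to each of them. *)
Definition stasheff m :=
  forall vs, vs != [::] ->
    \sum_(0 <= r < size vs) \sum_(1 <= s < (size vs - r).+1)
      (-1) ^+ (r + s * (size vs - r - s)) *:
        m (map (iter s (signop pr)) (take r vs)
             ++ m (take s (drop r vs)) :: drop (r + s) vs) = 0.

Definition strictly_unital (e : V) m :=
  [/\ pr false e = e,
      m [:: e] = 0,
      forall v, m [:: e; v] = v /\ m [:: v; e] = v
    & forall vs, (3 <= size vs)%N -> e \in vs -> m vs = 0].

Definition minimal m := forall v, m [:: v] = 0.

Definition Ainfty m := [/\ multilinear m, graded_ops m & stasheff m].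

End AInfinity.

(** * Homotopy transfer

  Merkulov's form of the sum over trees, for [id - iota pi = dh + hd] and the
  signs of [stasheff]:
    [lambda_n = \sum_(s+t = n) (-1)^(s+1) lambda_2 (h lambda_s (x) h lambda_t)],
  with [h lambda_1 = - id].  As [h lambda_t] has parity [odd (t-1)], the Koszul
  rule applies [signop ^ (t-1)] to the arguments of [h lambda_s]. *)

Section Transfer.
Context {A : nzRingType} {V : zmodType}.
Variables (pr : bool -> A -> A) (h : A -> A) (iota : V -> A) (pi : A -> V).

(** [fuel] bounds the depth of the recursion; any [fuel >= size xs] gives the
  same value, see [lambdaE]. *)
Fixpoint lambda_rec (fuel : nat) (xs : seq A) : A :=
  if fuel is fuel'.+1 then
    let hl ys :=
      if (size ys <= 1)%N then - head 0 ys else h (lambda_rec fuel' ys) in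
    \sum_(1 <= s < size xs)
      (-1) ^+ s.+1 *
      (hl (map (iter (size xs - s).-1 (signop pr)) (take s xs)) *
       hl (drop s xs))
  else 0.

Definition lambda (xs : seq A) : A := lambda_rec (size xs) xs.

Definition hlambda (xs : seq A) : A :=
  if (size xs <= 1)%N then - head 0 xs else h (lambda xs).

Definition transfer (vs : seq V) : V :=
  if (size vs <= 1)%N then 0 else pi (lambda (map iota vs)).

Let lambda_rec_fuel n1 n2 xs :
  (size xs <= n1)%N -> (size xs <= n2)%N -> lambda_rec n1 xs = lambda_rec n2 xs.
Proof.
elim: n1 n2 xs => [|n1 IH] [|n2] xs //.
- by rewrite leqn0 => /nilP -> _ /=; rewrite big_geq.
- by move=> _; rewrite leqn0 => /nilP -> /=; rewrite big_geq.
move=> le1 le2 /=; apply: eq_big_nat => s /andP[s_gt0 s_lt].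
have szt : (size (take s xs) < size xs)%N by rewrite size_take s_lt.
have szd : (size (drop s xs) < size xs)%N.
  by rewrite size_drop ltn_subrL s_gt0 (leq_ltn_trans _ s_lt).
rewrite !size_map (IH n2 (drop s xs)) ?(IH n2 (map _ _)) ?size_map //.
all: by rewrite -ltnS; apply: leq_trans; eassumption.
Qed.

Lemma lambdaE xs :
  lambda xs =
  \sum_(1 <= s < size xs) (-1) ^+ s.+1 *
    (hlambda (map (iter (size xs - s).-1 (signop pr)) (take s xs)) *
     hlambda (drop s xs)).
Proof.
rewrite {1}/lambda (lambda_rec_fuel (leqnn _) (leqnSn _)) /=.
apply: eq_big_nat => s /andP[s_gt0 s_lt].
rewrite /hlambda /lambda; congr (_ * (_ * _)).
  rewrite (@lambda_rec_fuel _ (size (take s xs))) ?size_map //.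
  by rewrite size_take s_lt ltnW.
by rewrite (@lambda_rec_fuel _ (size (drop s xs))) // size_drop leq_subr.
Qed.

Lemma lambda2 x y : lambda [:: x; y] = x * y.
Proof.
rewrite lambdaE /= big_nat1 /= /hlambda /=.
by rewrite mulrNN -signr_odd /= expr0 mul1r.
Qed.

End Transfer.

(** * The endomorphism dg algebra of the stabilized residue field

  The stabilized residue field of [w] is the matrix factorization
  [R (+) R theta], [R = k[[x]]], with odd endomorphism
  [delta = x d/dtheta + (w/x) theta] squaring to [w].  Its endomorphism algebra
  is the algebra of 2 x 2 matrices over [R] (acting on columns), in which
  [theta] is the multiplication by [theta] and [del] is [d/dtheta];
  [endA_basis] and [clifford_rel] identify it with
  [k[[x]] (x) k<theta, del>]. *)

Section EndAlgebra.
Context {k : fieldType}.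
Local Notation A := 'M[fps k]_2.

Definition theta : A := delta_mx 1 0.
Definition del : A := delta_mx 0 1.

Definition prA (b : bool) (f : A) : A :=
  \matrix_(i, j) if odd (i + j) == b then f i j else 0.

Variable w : fps k.

Definition delta : A := fpsX *: del + fps_divX w *: theta.

(** The supercommutator with [delta]; see [dA_linear], [dA_leibniz] and
  [dA_generators]. *)
Definition dA (f : A) : A := delta *m f - signop prA f *m delta.

(** [h (a xi) = (abar / x) theta xi]; see [hA_tensor] and [hA_additive]. *)
Definition hA (f : A) : A := theta *m map_mx fps_divX f.

(** Entrywise computation: [mk2 a b c d] is the matrix with rows [(a, b)] and
  [(c, d)]. *)
Definition mk2 : fps k -> fps k -> fps k -> fps k -> A := locked (fun a b c d =>
  \matrix_(i, j) if i == 0 then if j == 0 then a else b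
                 else if j == 0 then c else d).

Lemma mk2E a b c d i j : mk2 a b c d i j =
  if i == 0 then if j == 0 then a else b else if j == 0 then c else d.
Proof. by rewrite /mk2 -lock mxE. Qed.

Lemma mx2P (f g : A) :
  f 0 0 = g 0 0 -> f 0 1 = g 0 1 -> f 1 0 = g 1 0 -> f 1 1 = g 1 1 -> f = g.
Proof.
move=> e00 e01 e10 e11; apply/matrixP.
suff ord2 (i : 'I_2) : i = 0 \/ i = 1.
  by move=> i j; case: (ord2 i) => ->; case: (ord2 j) => ->.
by case: i => -[|[|//]] ?; [left | right]; apply: val_inj.
Qed.

Lemma mk2_eta (f : A) : f = mk2 (f 0 0) (f 0 1) (f 1 0) (f 1 1).
Proof. by apply: mx2P; rewrite mk2E. Qed.

Lemma mk2_mul a b c d a' b' c' d' : mk2 a b c d *m mk2 a' b' c' d' =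
  mk2 (a * a' + b * c') (a * b' + b * d') (c * a' + d * c') (c * b' + d * d').
Proof.
by apply: mx2P; rewrite mxE big_ord_recl big_ord1 !mk2E.
Qed.

Lemma mk2_add a b c d a' b' c' d' : mk2 a b c d + mk2 a' b' c' d' =
  mk2 (a + a') (b + b') (c + c') (d + d').
Proof. by apply: mx2P; rewrite mxE !mk2E. Qed.

Lemma mk2_opp a b c d : - mk2 a b c d = mk2 (- a) (- b) (- c) (- d).
Proof. by apply: mx2P; rewrite mxE !mk2E. Qed.

Lemma mk2_scale e a b c d :
  e *: mk2 a b c d = mk2 (e * a) (e * b) (e * c) (e * d).
Proof. by apply: mx2P; rewrite mxE !mk2E. Qed.

Lemma mk2_scalar a : a%:M = mk2 a 0 0 a.
Proof. by apply: mx2P; rewrite mxE !mk2E. Qed.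

Lemma mk2_0 : 0 = mk2 0 0 0 0.
Proof. by apply: mx2P; rewrite mxE !mk2E. Qed.

Lemma mk2_map (F : fps k -> fps k) a b c d :
  map_mx F (mk2 a b c d) = mk2 (F a) (F b) (F c) (F d).
Proof. by apply: mx2P; rewrite mxE !mk2E. Qed.

Lemma mk2_sign a b c d : signop prA (mk2 a b c d) = mk2 a (- b) (- c) d.
Proof.
by apply: mx2P; rewrite /signop !mxE /= !mk2E /= ?subr0 ?sub0r.
Qed.

Lemma mk2_theta : theta = mk2 0 0 1 0.
Proof. by apply: mx2P; rewrite mxE mk2E. Qed.

Lemma mk2_del : del = mk2 0 1 0 0.
Proof. by apply: mx2P; rewrite mxE mk2E. Qed.

Lemma mk2_inj a b c d a' b' c' d' : mk2 a b c d = mk2 a' b' c' d' ->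
  [/\ a = a', b = b', c = c' & d = d'].
Proof.
by move=> e; move: (e); split; [move: (congr1 (fun f : A => f 0 0) e)
 | move: (congr1 (fun f : A => f 0 1) e) | move: (congr1 (fun f : A => f 1 0) e)
 | move: (congr1 (fun f : A => f 1 1) e)]; rewrite !mk2E.
Qed.

Definition mk2s := (mk2_theta, mk2_del, mk2_0, mk2_scalar, mk2_mul, mk2_scale,
  mk2_opp, mk2_add, mk2_sign, mk2_map).

Lemma clifford_rel :
  [/\ theta *m theta = 0, del *m del = 0
    & theta *m del + del *m theta = 1%:M].
Proof. by split; rewrite !mk2s; congr mk2; ring. Qed.

Lemma endA_basis (f : A) :
  exists! c : fps k * fps k * fps k * fps k,
    f = c.1.1.1 *: 1%:M + c.1.1.2 *: theta + c.1.2 *: del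
        + c.2 *: (theta *m del).
Proof.
rewrite (mk2_eta f) !mk2s.
exists (f 0 0, f 1 0, f 0 1, f 1 1 - f 0 0); split=> [|[[[a b] c] e]] /=.
by rewrite !mk2s; congr mk2; ring.
rewrite !mk2s => /mk2_inj[-> -> -> ->].
by congr (_, _, _, _); ring.
Qed.

Lemma parity_generators : prA true theta = theta /\ prA true del = del.
Proof. by split; apply: mx2P; rewrite !mxE. Qed.

Lemma dA_linear (a : fps k) (f g : A) : dA (a *: f + g) = a *: dA f + dA g.
Proof.
rewrite /dA /delta (mk2_eta f) (mk2_eta g).
by rewrite !mk2s; congr mk2; ring.
Qed.

Lemma dA_leibniz (f g : A) : dA (f *m g) = dA f *m g + signop prA f *m dA g.
Proof.
rewrite /dA /delta (mk2_eta f) (mk2_eta g).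
by rewrite !mk2s; congr mk2; ring.
Qed.

Lemma dA_sq f : dA (dA f) = 0.
Proof.
rewrite /dA /delta (mk2_eta f).
by rewrite !mk2s; congr mk2; ring.
Qed.

Lemma dA_generators :
  dA theta = fpsX%:M /\ dA del = (fps_divX w)%:M.
Proof.
by split; rewrite /dA /delta !mk2s; congr mk2; ring.
Qed.

Lemma hA_tensor (a : fps k) (xi : 'M[k]_2) :
  hA (a *: map_mx fpsC xi) = (fps_divX a *: theta) *m map_mx fpsC xi.
Proof.
rewrite /hA -scalemxAl scalemxAr; congr (theta *m _).
apply/matrixP => i j; rewrite !mxE; apply: fpsP => n.
by rewrite fps_mulCE; apply: (fps_mulCE a _ n.+1).
Qed.

Lemma hA_additive (f g : A) : hA (f + g) = hA f + hA g.
Proof.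
rewrite /hA -mulmxDr; congr (_ *m _).
by apply/matrixP => i j; rewrite !mxE fps_divXD.
Qed.

Lemma delta_sq : w 0%N = 0 -> delta *m delta = w%:M.
Proof.
move=> w0; have wE : fpsX * fps_divX w = w.
  by rewrite fps_divXK w0; apply: fpsP => -[|n] /=; rewrite subr0.
by rewrite -[in RHS]wE /delta !mk2s; congr mk2; ring.
Qed.

(** * The cohomology [k 1 (+) k dbar] and the induced structure *)

Local Notation H := 'rV[k]_2.

Definition hone : H := delta_mx 0 0.
Definition dbar : H := delta_mx 0 1.

Definition prH (b : bool) (v : H) : H :=
  \row_j if odd j == b then v 0 j else 0.

Definition iotaA (v : H) : A :=
  (fpsC (v 0 0))%:M
  + fpsC (v 0 1) *: (del - fps_divX (fps_divX w) *: theta).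

(** The projection [p = id - (dh + hd)], read in the coordinates of its image;
  see [iota_piA]. *)
Definition piA (f : A) : H :=
  \row_j if j == 0 then f 0 0 0%N else f 0 1 0%N.

(** Every cohomology class is represented by [iotaA v] for exactly one [v]. *)
Definition cohomology_rep :=
  (forall v, dA (iotaA v) = 0) /\
  (forall f, dA f = 0 -> exists! v, exists g, f = iotaA v + dA g).

Lemma iota_piA (f : A) : w 0%N = 0 -> w 1%N = 0 ->
  iotaA (piA f) = f - (dA (hA f) + hA (dA f)).
Proof.
move=> w0 w1; rewrite /iotaA !mxE /= (mk2_eta f) !mk2E /=.
move: (f 0 0) (f 0 1) (f 1 0) (f 1 1) => a b c d.
have wE : fps_divX w = fpsX * fps_divX (fps_divX w).
  by rewrite fps_divXK /= w1; apply: fpsP => -[|n] /=; rewrite subr0.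
rewrite /dA /hA /delta wE !fps_divXM; set u := fps_divX (fps_divX w).
rewrite !mk2s.
have CE (g : fps k) : fpsC (g 0%N) = g - fpsX * fps_divX g.
  by rewrite fps_divXK subKr.
rewrite !CE.
set g1 := fps_divX (_ * a + _ * c - _).
have -> : g1 = c + u * b by rewrite -[RHS]fps_divXM; congr fps_divX; ring.
set g2 := fps_divX (_ * b + _ * d - _).
have -> : g2 = d - a by rewrite -[RHS]fps_divXM; congr fps_divX; ring.
by congr mk2; ring.
Qed.

Lemma piA_iota v : piA (iotaA v) = v.
Proof.
have -> : iotaA v = mk2 (fpsC (v 0 0)) (fpsC (v 0 1))
    (- (fpsC (v 0 1) * fps_divX (fps_divX w))) (fpsC (v 0 0)).
  by rewrite /iotaA !mk2s; congr mk2; ring.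
apply/rowP => -[[|[|//]] lti]; rewrite !mxE !mk2E /=.
  by congr (v 0 _); apply: val_inj.
by congr (v 0 _); apply: val_inj.
Qed.

Definition induced_ops : seq H -> H := transfer prA hA iotaA piA.

End EndAlgebra.

Arguments hone k : clear implicits.
Arguments dbar k : clear implicits.

(* Main.v *)
Require Import Defs.
From mathcomp Require Import all_boot all_order all_algebra.
From mathcomp Require Import boolp ring zify.

Set Implicit Arguments.
Unset Strict Implicit.
Unset Printing Implicit Defensive.

Import GRing.Theory.
Local Open Scope ring_scope.

(** Write [D] for the representative [del - (w/x^2) theta] of [dbar].  The image
  of [h] is [theta A]; as [theta^2 = 0] and [h], [piA] only see the first row of a
  matrix, [lambda_n] may be replaced by its term [x_1 * h lambda_(n-1)].  By
  induction [lambda_n (D, .., D)] agrees, up to the sign [(-1)^C(n,2)] and a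
  multiple of [theta], with the series [w / x^n] deprived of its polar part,
  whose constant term is [r_n].  Hence
    [m_n (v_1, .., v_n) = (-1)^C(n,2) r_n b_1 .. b_n 1], [v_i = a_i 1 + b_i dbar],
  to which the product of the exterior algebra on [dbar] is added for [n = 2].
  The Stasheff identities for these operations reduce to a telescoping sum, and
  multilinearity together with strict unitality leaves no freedom beyond the
  values [m_n (dbar, .., dbar)]. *)

(** * Sums with a single nonzero term, and multilinear maps *)

Lemma big_nat_single (V : nmodType) (a b c : nat) (F : nat -> V) :
  (forall i, (a <= i < b)%N -> i != c -> F i = 0) ->
  \sum_(a <= i < b) F i = if (a <= c < b)%N then F c else 0.
Proof.
move=> F0; rewrite -(big_nat1_eq +%R) [RHS]big_mkcond.
by apply: eq_big_nat => i le_i; case: ifPn => // /(F0 i le_i).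
Qed.

Lemma multilinear0 (k : fieldType) (V : lmodType k) (m : seq V -> V)
    (vs1 vs2 : seq V) :
  multilinear m -> m (vs1 ++ 0 :: vs2) = 0.
Proof.
move=> lin; have := lin vs1 vs2 1 0 0; rewrite !scale1r addr0 => /esym/eqP.
by rewrite -[X in _ == X]addr0 (inj_eq (addrI _)) => /eqP.
Qed.

Section InducedStructure.
Variable k : fieldType.
Local Notation H := 'rV[k]_2.
Implicit Types (u v : H) (vs : seq H) (w : fps k).

(** * Coordinates on cohomology and the model operations *)

Lemma rV2P u v : u 0 0 = v 0 0 -> u 0 1 = v 0 1 -> u = v.
Proof.
move=> e0 e1; apply/rowP => -[[|[|//]] lti].
- by rewrite (_ : Ordinal lti = 0) //; apply: val_inj.
- by rewrite (_ : Ordinal lti = 1) //; apply: val_inj.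
Qed.

(** The product of the exterior algebra: coordinate 0 is the coefficient of 1, coordinate 1 that of
    [dbar], and [dbar] squares to zero. *)
Definition wedge u v : H :=
  \row_j if j == 0 then u 0 0 * v 0 0 else u 0 0 * v 0 1 + u 0 1 * v 0 0.

Definition wedge_op vs : H := if vs is [:: u; v] then wedge u v else 0.

Definition dprod vs : k := \prod_(v <- vs) v 0 1.

Definition twisted_coef w n : k := (-1) ^+ odd 'C(n, 2) * w n.

(* When [w 1 = 0], this formula also gives [m_1 = 0]. *)
Definition model_ops w vs : H :=
  wedge_op vs + (dprod vs * twisted_coef w (size vs)) *: hone k.

Lemma hone_0 : hone k 0 0 = 1. Proof. by rewrite mxE. Qed.
Lemma hone_1 : hone k 0 1 = 0. Proof. by rewrite mxE. Qed.
Lemma dbar_1 : dbar k 0 1 = 1. Proof. by rewrite mxE. Qed.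
Lemma wedge0 u v : wedge u v 0 0 = u 0 0 * v 0 0. Proof. by rewrite mxE. Qed.
Lemma wedge1 u v : wedge u v 0 1 = u 0 0 * v 0 1 + u 0 1 * v 0 0.
Proof. by rewrite mxE. Qed.

Lemma dprod_cons v vs : dprod (v :: vs) = v 0 1 * dprod vs.
Proof. exact: big_cons. Qed.

Lemma dprod_cat vs1 vs2 : dprod (vs1 ++ vs2) = dprod vs1 * dprod vs2.
Proof. exact: big_cat. Qed.

Lemma dprod0 : dprod [::] = 1. Proof. exact: big_nil. Qed.

Lemma model_ops0 w vs :
  model_ops w vs 0 0 = wedge_op vs 0 0 + dprod vs * twisted_coef w (size vs).
Proof. by rewrite !mxE mulr1. Qed.

Lemma model_ops1 w vs : model_ops w vs 0 1 = wedge_op vs 0 1.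
Proof. by rewrite !mxE mulr0 addr0. Qed.

Lemma sign0 v : signop (@prH k) v 0 0 = v 0 0.
Proof. by rewrite !mxE /= subr0. Qed.
Lemma sign1 v : signop (@prH k) v 0 1 = - v 0 1.
Proof. by rewrite !mxE /= sub0r. Qed.
Lemma iter_sign0 s v : iter s (signop (@prH k)) v 0 0 = v 0 0.
Proof. by elim: s => //= s IH; rewrite sign0. Qed.
Lemma iter_sign1 s v : iter s (signop (@prH k)) v 0 1 = (-1) ^+ s * v 0 1.
Proof.
by elim: s => [|s IH] /=; rewrite ?mul1r // sign1 IH exprS mulN1r mulNr.
Qed.

(** The sign picked up when passing from n to n + 1 arguments: a minus sign and n - 1 applications
    of [signop] to an odd element. *)
Lemma sign_bin2S n :
  (-1) ^+ odd 'C(n.+1, 2) = (-1) ^+ n * (-1) ^+ odd 'C(n, 2) :> k.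
Proof. by rewrite binS bin1 !signr_odd exprD mulrC. Qed.

(** * Closed form of the transferred operations *)

Lemma fpsC0 : fpsC 0 = 0 :> fps k. Proof. by []. Qed.
Lemma fpsC1 : fpsC 1 = 1 :> fps k. Proof. by []. Qed.

Lemma fpsCD (a b : k) : fpsC (a + b) = fpsC a + fpsC b.
Proof. by apply: fpsP => -[|n] /=; rewrite ?addr0. Qed.

Lemma fpsCM (a b : k) : fpsC (a * b) = fpsC a * fpsC b.
Proof. by apply: fpsP => -[|n]; rewrite fps_mulCE /= ?mul0r. Qed.

Lemma fpsCN (a : k) : fpsC (- a) = - fpsC a.
Proof. by apply: fpsP => -[|n] /=; rewrite ?oppr0. Qed.

Lemma fps_divX_C (a : k) : fps_divX (fpsC a) = 0.
Proof. by apply: fpsP => -[]. Qed.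

Lemma fps_divX_Cmul (a : k) (f : fps k) :
  fps_divX (fpsC a * f) = fpsC a * fps_divX f.
Proof.
apply: fpsP => n; rewrite ![fpsC a * _]mulrC fps_mulCE.
exact: (fps_mulCE f a n.+1).
Qed.

Lemma iotaE w v : iotaA w v = mk2 (fpsC (v 0 0)) (fpsC (v 0 1))
  (- (fpsC (v 0 1) * fps_divX (fps_divX w))) (fpsC (v 0 0)).
Proof. by rewrite /iotaA !mk2s; congr mk2; ring. Qed.

Lemma iter_sign_iota w s v : iter s (signop prA) (iotaA w v)
  = iotaA w (iter s (signop (@prH k)) v).
Proof.
elim: s => //= s ->; rewrite !iotaE mk2_sign sign0 sign1 fpsCN.
by congr mk2; ring.
Qed.

Lemma hAE (f : 'M[fps k]_2) :
  hA f = mk2 0 0 (fps_divX (f 0 0)) (fps_divX (f 0 1)).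
Proof. by rewrite /hA {1}(mk2_eta f) !mk2s; congr mk2; ring. Qed.

Lemma hA_row (f : 'M[fps k]_2) : row 0 (hA f) = 0.
Proof. by apply/rowP => j; rewrite hAE !mxE mk2E; case: ifP. Qed.

(* Elements of the image of [h] have zero first row, so among the products
  making up [lambda_n] only the one with a bare left factor contributes to the
  first row, and both [h] and the projection see nothing but that row. *)
Lemma row_lambda_cons w v vs : (2 <= size vs)%N ->
  row 0 (lambda prA (@hA k) (map (iotaA w) (v :: vs))) =
  row 0 (- iotaA w (iter (size vs).-1 (signop (@prH k)) v)
           *m hA (lambda prA (@hA k) (map (iotaA w) vs))).
Proof.
move=> sz; rewrite lambdaE size_map big_ltn ?ltnS ?(ltnW sz) //.
rewrite raddfD /= raddf_sum /= big1_seq ?addr0.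
  rewrite drop0 take0 /= subn1 iter_sign_iota sqrrN expr1n mul1r.
  by rewrite /hlambda /= size_map leqNgt sz mulmxE.
move=> s /andP[_]; rewrite mem_index_iota => /andP[s2 sn].
rewrite -signr_odd mulr_sign -mulmxE -map_cons; set xs := map _ (take _ _).
have xsE : hlambda prA (@hA k) xs = hA (lambda prA (@hA k) xs).
  by rewrite /hlambda ifN // -ltnNge /xs size_map size_take /= size_map sn.
by case: odd; rewrite ?raddfN /= row_mul xsE hA_row mul0mx ?oppr0.
Qed.

(** By [row_lambda_cons], prepending [v] applies [fps_divX] to the first row and scales it by the
    signed [dbar] coefficient of [v]. As [fps_divX] kills constants, the wedge terms survive only
    for two arguments. *)
Lemma lambda_iota_row w vs : (2 <= size vs)%N ->
  let f := lambda prA (@hA k) (map (iotaA w) vs) in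
  f 0 0 = fpsC (wedge_op vs 0 0)
    + fpsC (dprod vs * (-1) ^+ odd 'C(size vs, 2))
      * iter (size vs) fps_divX w
  /\ f 0 1 = fpsC (wedge_op vs 0 1).
Proof.
elim: vs => [|v vs IH] // sz f.
have [sz1|sz2] : size vs = 1%N \/ (2 <= size vs)%N.
- by case: vs sz {IH f} => [|? [|]] //; [left | right].
- case: vs sz1 @f {IH sz} => [|u [|? ?]] // _ f.
  rewrite {}/f lambda2 !iotaE -mulmxE mk2_mul !mk2E /=.
  rewrite !dprod_cons dprod0 !wedge0 !wedge1 mulr1.
  by rewrite expr1 mulrN1 !(fpsCD, fpsCN, fpsCM); split; ring.
have [f0 f1] := IH sz2.
have -> : wedge_op (v :: vs) = 0 by case: vs sz2 {sz IH f f0 f1} => [|? [|]].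
have fE j : f 0 j = row 0 f 0 j by rewrite mxE.
rewrite !fE row_lambda_cons // iotaE hAE mk2_opp mk2_mul.
rewrite ![row _ _ _ _]mxE !mk2E /= f0 f1 !mxE fps_divXD fps_divX_Cmul !fps_divX_C.
rewrite iter_sign0 iter_sign1 dprod_cons sign_bin2S.
case: vs sz2 {sz IH f fE f0 f1} => //= u vs _.
rewrite exprS fpsC0.
by split; rewrite !(fpsCM, fpsCN, fpsC1); ring.
Qed.

Lemma induced_opsE w : w 0%N = 0 -> w 1%N = 0 -> induced_ops w = model_ops w.
Proof.
move=> w0 w1; apply: funext => vs; rewrite /induced_ops /transfer.
case: leqP => [le1|gt1].
  (* On at most one argument [transfer] is 0 by definition; the model agrees because [w 0] and [w 1]
     vanish. *)
  case: vs le1 => [|v [|? ?]] //= _; apply: rV2P;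
    by rewrite ?(model_ops0, model_ops1) /= !mxE /twisted_coef ?(w0, w1) ?mulr0
      ?addr0.
have [f0 f1] := lambda_iota_row w gt1.
have iterE n i : iter n fps_divX w i = w (n + i)%N.
  by elim: n i => //= n IH i; rewrite IH addnS.
apply: rV2P; rewrite ?model_ops0 ?model_ops1 mxE /= ?f0 ?f1 //.
by rewrite /= big_ord1 /= iterE addn0 /twisted_coef mulrA.
Qed.

(** * Multilinearity, parity and unitality of the model *)

Lemma model_multilinear w : multilinear (model_ops w).
Proof.
move=> vs1 vs2 a u v.
apply: rV2P; rewrite !mxE !size_cat /= !dprod_cat !dprod_cons !mxE.
all: by case: vs1 => [|x [|y [|z vs1]]]; case: vs2 => [|x' [|y' vs2]] //=;
    rewrite !mxE /=; ring.
Qed.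

Lemma prH0 b v : prH b v 0 0 = if b then 0 else v 0 0.
Proof. by rewrite mxE; case: b. Qed.
Lemma prH1 b v : prH b v 0 1 = if b then v 0 1 else 0.
Proof. by rewrite mxE; case: b. Qed.

Lemma model_graded w : graded_ops (@prH k) (model_ops w).
Proof.
move=> vs ps _ hom; rewrite /model_ops.
have prHD b u v : prH b (u + v) = prH b u + prH b v.
  by apply: rV2P; rewrite [RHS]mxE ?prH0 ?prH1 !mxE; case: b; rewrite ?addr0.
have prH00 b : prH b 0 = 0 :> H.
  by apply: rV2P; rewrite ?prH0 ?prH1 !mxE; case: b.
rewrite prHD; congr (_ + _).
  case: ps vs hom => [|p [|q [|? ?]]] [|u [|v [|? ?]]] //=;
    rewrite ?andbF // => hom; rewrite ?prH00 //; move: hom.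
  case/and3P=> [/eqP <- /eqP <- _]; apply: rV2P;
  rewrite ?prH0 ?prH1 ?wedge0 ?wedge1 ?prH0 ?prH1.
    by case: p; case: q; rewrite /= ?mul0r ?mulr0.
  by case: p; case: q; rewrite /= ?mul0r ?mulr0 ?add0r ?addr0.
(* If all arguments are odd, the required parity is even, as is 1; otherwise an even argument makes
   [dprod] vanish. *)
have [allp|] := boolP (all id ps).
  have szp : size ps = size vs.
    by elim: ps vs hom {allp} => [|p ps IH] [|v vs] //= /andP[_ /IH ->].
  move: allp; rewrite all_count szp => /eqP ->; rewrite addbb.
  by apply: rV2P; rewrite ?prH0 ?prH1 !mxE /= ?mulr0.
move=> nall; have -> : dprod vs = 0.
  elim: ps vs hom nall => [|p ps IH] [|v vs] //= /andP[/eqP ev /IH IHv].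
  rewrite dprod_cons; case: p ev => /= ev; first by move=> /IHv ->; rewrite mulr0.
  by rewrite -ev prH1 mul0r.
by rewrite mul0r scale0r prH00.
Qed.

Lemma model_unital w : w 1%N = 0 ->
  strictly_unital (@prH k) (hone k) (model_ops w).
Proof.
move=> w1; split.
- by apply: rV2P; rewrite ?prH0 ?prH1 ?hone_1.
- by rewrite /model_ops /= add0r /twisted_coef w1 !mulr0 scale0r.
- move=> v; split; apply: rV2P;
  rewrite ?(model_ops0, model_ops1) /= ?(wedge0, wedge1) ?dprod_cons
    ?(hone_0, hone_1); ring.
move=> vs sz vs1; rewrite /model_ops.
have -> : wedge_op vs = 0 by case: vs sz {vs1} => [|x [|y [|z ?]]].
case/splitPr: vs1 => p q.
by rewrite dprod_cat dprod_cons hone_1 mul0r mulr0 mul0r scale0r addr0.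
Qed.

Lemma model_dbar w i : (2 <= i)%N ->
  model_ops w (nseq i (dbar k)) = ((-1) ^+ odd 'C(i, 2) * w i) *: hone k.
Proof.
move=> i2; rewrite /model_ops size_nseq /twisted_coef.
have -> : dprod (nseq i (dbar k)) = 1.
  by elim: i {i2} => [|i IH] /=; rewrite ?dprod0 // dprod_cons IH dbar_1 mulr1.
suff -> : wedge_op (nseq i (dbar k)) = 0 by rewrite add0r mul1r.
case: i i2 => [|[|[|i]]] //= _.
by apply: rV2P; rewrite ?wedge0 ?wedge1 !mxE /= !(mul0r, mulr0) ?addr0.
Qed.

(** * Uniqueness *)

Lemma multilinear_ext (m m' : seq H -> H) :
  multilinear m -> multilinear m' ->
  (forall vs, vs != [::] -> {subset vs <= [:: hone k; dbar k]} -> m vs = m' vs) ->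
  forall vs, vs != [::] -> m vs = m' vs.
Proof.
move=> lin lin' eqm vs.
have linE n (linn : multilinear n) vs1 vs2 v : n (vs1 ++ v :: vs2) =
   v 0 0 *: n (vs1 ++ hone k :: vs2) + v 0 1 *: n (vs1 ++ dbar k :: vs2).
  (* The trailing 0 gives both summands the shape required by [multilinear]; [multilinear0] then
     removes it. *)
  have ev : v = v 0 0 *: hone k + (v 0 1 *: dbar k + 0).
    by apply: rV2P; rewrite !mxE /=; ring.
  by rewrite {1}ev !linn multilinear0 ?addr0.
(* Arguments are expanded from left to right; the prefix [vs1] already consists of basis vectors. *)
suff main vs1 : vs1 ++ vs != [::] -> {subset vs1 <= [:: hone k; dbar k]} ->
    m (vs1 ++ vs) = m' (vs1 ++ vs) by move=> nz; apply: (main [::]).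
elim: vs vs1 => [|v vs IH] vs1 nz sub; first by rewrite cats0 in nz *; apply: eqm.
rewrite linE // [RHS]linE // -!cat_rcons !IH //.
- by rewrite cat_rcons; case: (vs1).
- by move=> x; rewrite mem_rcons !inE => /predU1P[->|/sub]; rewrite ?eqxx ?orbT ?inE.
- by rewrite cat_rcons; case: (vs1).
- by move=> x; rewrite mem_rcons !inE => /predU1P[->|/sub]; rewrite ?eqxx ?inE.
Qed.

(** On basis vectors, either 1 occurs and unitality fixes the value, or all arguments are [dbar]. *)
Lemma unital_ext (m m' : seq H -> H) :
  multilinear m -> multilinear m' ->
  strictly_unital (@prH k) (hone k) m -> strictly_unital (@prH k) (hone k) m' ->
  (forall n, (1 <= n)%N -> m (nseq n (dbar k)) = m' (nseq n (dbar k))) ->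
  forall vs, vs != [::] -> m vs = m' vs.
Proof.
move=> lin lin' [_ m1 m2 m3] [_ m1' m2' m3'] eqm.
apply: multilinear_ext => // vs nz sub.
have [in1|notin1] := boolP (hone k \in vs).
  have [sz|] := leqP 3 (size vs); first by rewrite m3 ?m3'.
  case: vs nz in1 {sub} => [|u [|v [|? ?]]] //= _; rewrite !inE.
    by move=> /eqP <-; rewrite m1 m1'.
  by case/orP=> /eqP <- _; rewrite ?(proj1 (m2 _)) ?(proj1 (m2' _))
     ?(proj2 (m2 _)) ?(proj2 (m2' _)).
suff -> : vs = nseq (size vs) (dbar k) by apply: eqm; rewrite lt0n size_eq0.
apply/all_pred1P/allP => v v_in /=; move: (sub _ v_in); rewrite !inE.
by case/orP=> // /eqP ev; rewrite -ev v_in in notin1.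
Qed.

(** * Representatives of cohomology classes *)

Lemma cohomology_rep_iota w : w 0%N = 0 -> w 1%N = 0 -> cohomology_rep w.
Proof.
move=> w0 w1.
have wE : fps_divX w = fpsX * fps_divX (fps_divX w).
  by rewrite fps_divXK /= w1; apply: fpsP => -[|n] /=; rewrite subr0.
split=> [v|f df].
  rewrite /dA /iotaA /delta wE fps_divXM; set u := fps_divX (fps_divX w).
  by rewrite !mk2s; congr mk2; ring.
(* For a cocycle, [iota_piA] exhibits the difference from its projection as the boundary of
   [hA f]. *)
exists (piA f); split.
  exists (hA f); rewrite iota_piA // df.
  have -> : hA 0 = 0 :> 'M[fps k]_2.
    by rewrite /hA; apply: mx2P; rewrite !mxE; apply: big1 => i _; rewrite !mxE;
     rewrite (_ : fps_divX 0 = 0) ?mulr0 //; apply: fpsP => -[].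
  by rewrite addr0 subrK.
move=> v [g fE].
have piD a b : piA (a + b) = piA a + piA b :> 'rV[k]_2.
  by apply: rV2P; rewrite !mxE.
rewrite fE piD piA_iota (_ : piA _ = 0) ?addr0 //.
set u := fps_divX (fps_divX w).
(* Every boundary is divisible by x, so [piA], which reads constant terms, kills it; this gives
   uniqueness. *)
have -> : dA w g = mk2 (fpsX * (g 1 0 + u * g 0 1)) (fpsX * (g 1 1 - g 0 0))
    (fpsX * (u * (g 0 0 - g 1 1))) (fpsX * (g 1 0 + u * g 0 1)).
  rewrite /dA /delta wE -/u {1 2}(mk2_eta g) !mk2s; congr mk2; ring.
by apply: rV2P; rewrite [LHS]mxE [RHS]mxE mk2E; exact: fps_mulXE.
Qed.

(** * Stasheff identities *)

Lemma wedgeA : associative wedge.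
Proof. by move=> u v z; apply: rV2P; rewrite ?(wedge0, wedge1); ring. Qed.

Lemma dprod_wedge_sum v0 vs z :
  let ws := v0 :: rcons vs z in
  \sum_(0 <= r < (size vs).+1) (-1) ^+ r *
     dprod (take r ws ++ wedge (nth 0 ws r) (nth 0 ws r.+1) :: drop r.+2 ws) =
  v0 0 0 * dprod (rcons vs z) + (-1) ^+ size vs * (dprod (v0 :: vs) * z 0 0).
Proof.
move=> ws.
(* Up to sign, the product of the [dbar] coefficients with the one at [r] replaced by the
   coefficient of 1. The two terms of [wedge1] are successive values, so the sum telescopes. *)
pose f r := (-1) ^+ r.+1 * (dprod (take r ws) * (nth 0 ws r 0 0)
   * dprod (drop r.+1 ws)).
have szw : size ws = (size vs).+2 by rewrite /= size_rcons.
transitivity (\sum_(0 <= r < (size vs).+1) (f r.+1 - f r)).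
  apply: eq_big_nat => r /andP[_ ltr].
  have ltr0 : (r < size ws)%N by rewrite szw ltnW.
  have ltr1 : (r.+1 < size ws)%N by rewrite szw.
  rewrite dprod_cat dprod_cons wedge1 /f (take_nth 0 ltr0) (drop_nth 0 ltr1).
  rewrite -cats1 dprod_cat !dprod_cons dprod0 !exprS; ring.
rewrite telescope_sumr // /f /ws /= drop0 dprod0.
rewrite drop_oversize ?size_rcons //.
rewrite dprod0 nth_rcons ltnn eqxx -cats1 take_size_cat // !dprod_cons !exprS.
ring.
Qed.

(** Terms can be nonzero only for three arguments, where the sum is the associator of [wedge]. *)
Lemma wedge_op_assoc vs :
  \sum_(0 <= r < (size vs).-1) (-1) ^+ r *:
    wedge_op (take r vs ++ wedge (nth 0 vs r) (nth 0 vs r.+1) :: drop r.+2 vs)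
  = 0.
Proof.
case: vs => [|x [|y [|z [|t vs]]]] /=.
- by rewrite big_geq.
- by rewrite big_geq.
- by rewrite big_nat1 scaler0.
- rewrite big_nat_recr //= big_nat1 /= expr0 expr1 scale1r scaleN1r wedgeA.
  exact: subrr.
rewrite big1_seq // => r; rewrite mem_index_iota => /andP[_ ltr].
set ws := _ ++ _.
have : (size ws = (size vs).+3)%N.
  by rewrite /ws size_cat /= size_takel ?size_drop /=; lia.
by case: ws => [|? [|? [|? ?]]] //= _; rewrite scaler0.
Qed.

Lemma wedge_op_size vs : size vs != 2%N -> wedge_op vs = 0.
Proof. by case: vs => [|? [|? [|? ?]]]. Qed.

Lemma signopK : involutive (signop (@prH k)).
Proof. by move=> v; apply: rV2P; rewrite ?sign0 ?sign1 ?opprK. Qed.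

Lemma model_stasheff w : w 1%N = 0 -> stasheff (@prH k) (model_ops w).
Proof.
move=> w1 vs; set m := model_ops w.
have [_ _ m2 m3] : strictly_unital (@prH k) (hone k) m by exact: model_unital.
have t1 : twisted_coef w 1 = 0 by rewrite /twisted_coef w1 mulr0.
have m_size1 v : m [:: v] = 0.
  by rewrite /m /model_ops /= t1 mulr0 scale0r addr0.
case/lastP: vs => [|[|v0 vs] z] // _; first by rewrite !big_nat1 !m_size1 scaler0.
rewrite rcons_cons; set ws := v0 :: _; pose N := size vs.
have szw : size ws = N.+2 by rewrite /= size_rcons.
pose c r s : k := (-1) ^+ (r + s * (size ws - r - s)).
pose pre r s := map (iter s (signop (@prH k))) (take r ws).
pose mid r s := take s (drop r ws).
(* The inner operation is a multiple of [1], on which only an outer [m_2] is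
  nonzero, plus a wedge, which is nonzero only for [s = 2]. *)
pose unit_part r s :=
  c r s *: ((dprod (mid r s) * twisted_coef w s) *:
    m (pre r s ++ hone k :: drop (r + s) ws)).
pose wedge_part r s :=
  c r s *: m (pre r s ++ wedge_op (mid r s) :: drop (r + s) ws).
have sz_mid r s : (r < N.+2)%N -> (s < (N.+2 - r).+1)%N -> size (mid r s) = s.
  by move=> ltr lts; rewrite size_takel // size_drop szw.
have sz_pre r s y : (r < N.+2)%N -> (s < (N.+2 - r).+1)%N ->
    size (pre r s ++ y :: drop (r + s) ws) = (N.+2 - s).+1.
  move=> ltr lts; rewrite size_cat /= size_map size_drop size_take szw ltr.
  lia.
transitivity (\sum_(0 <= r < N.+2) \sum_(1 <= s < (N.+2 - r).+1)
    (unit_part r s + wedge_part r s)).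
  rewrite szw; apply: eq_big_nat => r /andP[_ ltr].
  apply: eq_big_nat => s /andP[_ lts].
  rewrite /unit_part /wedge_part -scalerDr -model_multilinear -/m.
  by rewrite [in RHS]addrC -[in twisted_coef w s](sz_mid r s ltr lts) /c szw.
under eq_bigr do rewrite big_split.
rewrite big_split /=.
(* The outer arity is N + 3 - s: for s = N + 2 it is [m_1], which is zero, and for s at most N
   unitality gives 0. This leaves s = N + 1, hence r = 0 or 1. *)
have -> : \sum_(0 <= r < N.+2) \sum_(1 <= s < (N.+2 - r).+1) unit_part r s
   = unit_part 0 N.+1 + unit_part 1 N.+1.
  rewrite (eq_big_nat _ _ (F2 := fun r => if (r < 2)%N then unit_part r N.+1 else 0)).
    rewrite big_ltn // big_ltn // big1_seq /= ?addr0 //.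
    by move=> r; rewrite mem_index_iota => /andP[]; case: r => [|[]].
  move=> r /andP[_ ltr]; rewrite (big_nat_single (c := N.+1)).
    by congr (if _ then _ else _); lia.
  move=> s /andP[s_gt0 lts] neq; rewrite /unit_part.
  have := sz_pre r s (hone k) ltr lts; set L := _ ++ _ => szL.
  suff -> : m L = 0 by rewrite !scaler0.
  have [sN|sN] := eqVneq s N.+2.
    move: szL; rewrite sN subnn; case: L => [|x [|? ?]] // _; exact: m_size1.
  apply: m3; first by rewrite szL; lia.
  by rewrite mem_cat mem_head orbT.
(* Only s = 2 contributes, where the Koszul operator is [signop] squared, the identity; r = N + 1
   allows only s = 1 and drops out. *)
have -> : \sum_(0 <= r < N.+2) \sum_(1 <= s < (N.+2 - r).+1) wedge_part r s
   = \sum_(0 <= r < N.+1) (-1) ^+ r *: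
    m (take r ws ++ wedge (nth 0 ws r) (nth 0 ws r.+1) :: drop r.+2 ws).
  rewrite big_nat_recr // -[RHS]addr0; congr (_ + _); last first.
    apply: big1_seq => s; rewrite mem_index_iota subSnn => /andP[_ lts].
    rewrite /wedge_part wedge_op_size ?multilinear0 ?scaler0 //.
      exact: model_multilinear.
    rewrite sz_mid //; lia.
  apply: eq_big_nat => r /andP[_ ltr]; rewrite (big_nat_single (c := 2)).
    rewrite ifT; last by lia.
    have ltr1 : (r.+1 < size ws)%N by rewrite szw.
    rewrite /wedge_part /c exprD exprM sqrrN !expr1n mulr1; congr (_ *: m _).
    rewrite /pre (eq_map signopK) map_id /mid addn2.
    by rewrite (drop_nth 0 (ltnW ltr1)) (drop_nth 0 ltr1) /= take0.
  move=> s /andP[s_gt0 lts] neq.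
  rewrite /wedge_part wedge_op_size ?multilinear0 ?scaler0 //.
    exact: model_multilinear.
  by rewrite sz_mid // (ltn_trans ltr).
have -> : unit_part 0%N N.+1 =
    ((-1) ^+ N.+1 * (dprod (v0 :: vs) * twisted_coef w N.+1)) *: z.
  rewrite /unit_part /c /pre /mid /ws szw subn0 subSnn muln1 take0 drop0 -cats1.
  rewrite -cat_cons take_size_cat // drop_size_cat //= (proj1 (m2 z)).
  by rewrite scalerA.
have -> : unit_part 1%N N.+1 =
    (- (dprod (rcons vs z) * twisted_coef w N.+1)) *: iter N.+1 (signop (@prH k)) v0.
  rewrite /unit_part /c /pre /mid szw subn1 subnn muln0 expr1.
  have -> : take 1 ws = [:: v0] by rewrite /ws /= take0.
  have -> : drop 1 ws = rcons vs z by rewrite /ws /= drop0.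
  rewrite take_oversize ?size_rcons // drop_oversize ?szw //.
  by rewrite [_ ++ _]/= (proj2 (m2 _)) scaleN1r scaleNr.
have -> : \sum_(0 <= r < N.+1) (-1) ^+ r *:
    m (take r ws ++ wedge (nth 0 ws r) (nth 0 ws r.+1) :: drop r.+2 ws) =
   ((v0 0 0 * dprod (rcons vs z) + (-1) ^+ N * (dprod (v0 :: vs) * z 0 0))
     * twisted_coef w N.+1) *: hone k.
  (* The iterated products cancel by associativity; [dprod_wedge_sum] evaluates the remaining
     multiple of 1. *)
  have := wedge_op_assoc ws; rewrite szw /= => assoc.
  rewrite -dprod_wedge_sum /= -/ws -/N mulr_suml scaler_suml.
  rewrite -[RHS]add0r -[X in X + _]assoc.
  rewrite -big_split; apply: eq_big_nat => r /andP[_ ltr] /=.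
  rewrite /m /model_ops scalerDr scalerA -mulrA.
  congr (_ + (_ * (_ * twisted_coef w _)) *: _).
  have ler : (r <= size ws)%N by rewrite szw; lia.
  rewrite size_cat size_takel // /= size_drop /= ?size_rcons -/N; lia.
(* On the coefficient of 1, the unit terms cancel the telescoped sum; on that of [dbar], they cancel
   each other. *)
apply: rV2P; rewrite !mxE /= ?iter_sign0 ?iter_sign1 ?sign0 ?sign1 ?hone_0 ?hone_1.
  by rewrite exprS; ring.
by rewrite -!cats1 !dprod_cat !dprod_cons dprod0 exprS; ring.
Qed.

End InducedStructure.

Theorem theorem5p8 :
  exists sgn : nat -> bool,
  forall (k : fieldType) (r : nat -> k) (w : fps k),
    w = FPS (fun i => if (2 <= i)%N then r i else 0) ->
    w != 0 ->
    [/\ cohomology_rep w,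
        [/\ Ainfty (@prH k) (induced_ops w),
            strictly_unital (@prH k) (hone k) (induced_ops w)
          & minimal (induced_ops w)],
        forall i, (2 <= i)%N ->
          induced_ops w (nseq i (dbar k)) = ((-1) ^+ sgn i * r i) *: hone k
      & forall m : seq 'rV[k]_2 -> 'rV[k]_2,
          Ainfty (@prH k) m ->
          strictly_unital (@prH k) (hone k) m ->
          minimal m ->
          (forall i, (2 <= i)%N ->
             m (nseq i (dbar k)) = ((-1) ^+ sgn i * r i) *: hone k) ->
          forall vs, vs != [::] -> m vs = induced_ops w vs].
Proof.
exists (fun n => odd 'C(n, 2)) => k r w wE _.
have w0 : w 0%N = 0 by rewrite wE.
have w1 : w 1%N = 0 by rewrite wE.
have opsE : induced_ops w = model_ops w by exact: induced_opsE.
have dbarE i : (2 <= i)%N -> induced_ops w (nseq i (dbar k)) =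
    ((-1) ^+ odd 'C(i, 2) * r i) *: hone k.
  by move=> i2; rewrite opsE model_dbar // wE /= i2.
have lin : multilinear (induced_ops w) by rewrite opsE; exact: model_multilinear.
have unital : strictly_unital (@prH k) (hone k) (induced_ops w).
  by rewrite opsE; exact: model_unital.
split=> //.
- exact: cohomology_rep_iota.
- split=> //; split=> //; rewrite opsE.
    exact: model_graded.
  exact: model_stasheff.
move=> m [lin_m _ _] unital_m min_m dbar_m.
(* Minimality settles one argument [dbar]; the prescribed values settle two or more. *)
apply: unital_ext => // -[|[|n]] // _; first by rewrite min_m.
by rewrite dbar_m // dbarE.
Qed.
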